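(* Let $M$ be a smooth connected manifold with a linear connection $\nabla$ (a connection on $TM$) with curvature $\mathfrak{R}$. For every $1$-form $\theta\in\bigwedge^1(M)$ and every vector field $Z\in\mathfrak{X}(M)$, $$\mathfrak{R}_{\theta,Z}=d\omega_{\theta,Z}+\Psi_{\theta,Z},\qquad\text{equivalently}\qquad \mathfrak{R}_{\theta,Z}=d\omega_{\theta,Z}-\nabla\theta\wedge\nabla Z,$$ where, for $X,Y\in\mathfrak{X}(M)$, $\mathfrak{R}_{\theta,Z}(X,Y)=\theta(\mathfrak{R}(X,Y)Z)$, $\omega_{\theta,Z}(X)=\theta(\nabla_XZ)$ and $\Psi_{\theta,Z}(X,Y)=(\nabla_Y\theta)(\nabla_XZ)-(\nabla_X\theta)(\nabla_YZ)=-(\nabla\theta\wedge\nabla Z)(X,Y)$.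
   Context: $\mathfrak{X}(M)$ denotes smooth vector fields on $M$. The curvature is $\mathfrak{R}(X,Y)Z=\nabla_X\nabla_YZ-\nabla_Y\nabla_XZ-\nabla_{[X,Y]}Z$. The connection acts on $1$-forms by $(\nabla_X\theta)(Y)=X(\theta(Y))-\theta(\nabla_XY)$. By definition $(\nabla\theta\wedge\nabla Z)(X,Y):=(\nabla_X\theta)(\nabla_YZ)-(\nabla_Y\theta)(\nabla_XZ)$. The exterior derivative is normalized by $d\omega(X,Y)=X(\omega(Y))-Y(\omega(X))-\omega([X,Y])$. *)

(* Defs.v *)
From HB Require Import structures.
From mathcomp Require Import all_boot all_order all_algebra.
From mathcomp Require Import all_classical all_reals all_analysis.
From mathcomp Require Import ring.

Set Implicit Arguments.
Unset Strict Implicit.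
Unset Printing Implicit Defensive.

Import Order.TTheory GRing.Theory Num.Theory.
Import numFieldNormedType.Exports.

Local Open Scope classical_set_scope.
Local Open Scope ring_scope.

(** * Functions of class C^k on an open subset of R^n *)

Section SmoothOn.
Variables (R : realType) (n : nat).
Implicit Types (U : set 'rV[R]_n) (f g : 'rV[R]_n -> R) (k : nat).

(* [U] is meant to be open: the conditions involve the values of [f] near the
   points of [U]. *)
Fixpoint Ck k U f : Prop :=
  (forall x, U x -> {for x, continuous f}) /\
  (if k is k'.+1 then
     forall i : 'I_n, (forall x, U x -> derivable f x (delta_mx 0 i)) /\
                      Ck k' U ('D_(delta_mx 0 i) f)
   else True).

Definition smooth_on U f : Prop := forall k, Ck k U f.

Lemma Ck_cont k U f x : Ck k U f -> U x -> {for x, continuous f}.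
Proof. by case: k => [|k] [+ _]; apply. Qed.

Lemma CkW k U f : Ck k.+1 U f -> Ck k U f.
Proof.
elim: k f => [|k IH] f [cf df]; first by split.
by split=> // i; have [? ?] := df i; split=> //; apply: IH.
Qed.

Lemma near_open U x (P : 'rV[R]_n -> Prop) :
  open U -> U x -> (forall y, U y -> P y) -> \forall y \near x, P y.
Proof. by move=> oU Ux UP; apply: filterS (open_nbhs_nbhs (conj oU Ux)). Qed.

Lemma derive_ext_open U f g x v : open U -> U x -> (forall y, U y -> f y = g y) ->
  'D_v f x = 'D_v g x.
Proof.
move=> oU Ux fg.
have [->|v0] := eqVneq v 0; first by rewrite !derive0.
by apply: near_eq_derive => //; apply: near_open oU Ux fg.
Qed.

Lemma derivable_ext_open U f g x v : open U -> U x -> (forall y, U y -> f y = g y) ->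
  derivable f x v -> derivable g x v.
Proof.
move=> oU Ux fg; have [->|v0] := eqVneq v 0; first by move=> _; exact: derivable0.
by apply: near_eq_derivable => //; apply: near_open oU Ux fg.
Qed.

Lemma Ck_ext k U f g : open U -> (forall y, U y -> f y = g y) ->
  Ck k U f -> Ck k U g.
Proof.
move=> oU; have cfg f' g' x : (forall y, U y -> f' y = g' y) -> U x ->
    {for x, continuous f'} -> {for x, continuous g'}.
  move=> fg Ux cf; rewrite /prop_for /continuous_at -(fg x Ux).
  apply: cvg_trans cf; apply: (@near_eq_cvg _ _ (nbhs x)).
  exact: near_open oU Ux fg.
elim: k f g => [|k IH] f g fg [cf df].
  by split=> // x Ux; apply: (cfg f) => //; apply: cf.
split=> [x Ux|i]; first by apply: (cfg f) => //; apply: cf.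
have [df1 df2] := df i; split.
  by move=> x Ux; apply: (derivable_ext_open oU Ux fg); apply: df1.
by apply: IH df2 => y Uy; apply: derive_ext_open oU Uy fg.
Qed.

Lemma Ck_cst k U (a : R) : open U -> Ck k U (cst a).
Proof.
move=> oU; elim: k a => [|k IH] a; first by split=> // x _; exact: cst_continuous.
split=> [x _|i]; first exact: cst_continuous.
split=> [x _|]; first exact: derivable_cst.
by apply: Ck_ext (IH 0) => // y _; rewrite derive_cst.
Qed.

Lemma Ck_add k U f g : open U -> Ck k U f -> Ck k U g -> Ck k U (f + g).
Proof.
move=> oU; elim: k f g => [|k IH] f g Cf Cg; have [cf df] := Cf;
  have [cg dg] := Cg.
  by split=> // x Ux; apply: continuousD; [exact: cf|exact: cg].
split=> [x Ux|i]; first by apply: continuousD; [exact: cf|exact: cg].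
have [f1 f2] := df i; have [g1 g2] := dg i; split=> [x Ux|].
  by apply: derivableD; [exact: f1|exact: g1].
apply: Ck_ext (IH _ _ f2 g2) => // y Uy.
by rewrite deriveD //; [exact: f1|exact: g1].
Qed.

Lemma Ck_mul k U f g : open U -> Ck k U f -> Ck k U g -> Ck k U (f * g).
Proof.
move=> oU; elim: k f g => [|k IH] f g Cf Cg; have [cf df] := Cf;
  have [cg dg] := Cg.
  by split=> // x Ux; apply: continuousM; [exact: cf|exact: cg].
split=> [x Ux|i]; first by apply: continuousM; [exact: cf|exact: cg].
have [f1 f2] := df i; have [g1 g2] := dg i; split=> [x Ux|].
  by apply: derivableM; [exact: f1|exact: g1].
have := Ck_add oU (IH _ _ (CkW Cf) g2) (IH _ _ (CkW Cg) f2).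
apply: Ck_ext => // y Uy.
by rewrite deriveM //; [exact: f1|exact: g1].
Qed.

End SmoothOn.

(** * Smooth manifolds *)

(* A chart is a homeomorphism from the open set [chart_dom] onto an open subset
   of R^n; both maps are total functions, whose values outside of these open
   sets are irrelevant. *)
Record chart (R : realType) (n : nat) (M : topologicalType) := Chart {
  chart_dom : set M;
  chart_map : M -> 'rV[R]_n;
  chart_inv : 'rV[R]_n -> M;
  chart_dom_open : open chart_dom;
  chart_img_open : open (chart_map @` chart_dom);
  chart_mapK : forall p, chart_dom p -> chart_inv (chart_map p) = p;
  chart_map_continuous : {within chart_dom, continuous chart_map};
  chart_inv_continuous :
    {within chart_map @` chart_dom, continuous chart_inv} }.

Definition chart_img (R : realType) n M (c : @chart R n M) : set 'rV[R]_n :=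
  chart_map c @` chart_dom c.

Definition smooth_transition (R : realType) n M (c d : @chart R n M) : Prop :=
  forall i : 'I_n, smooth_on (chart_map c @` (chart_dom c `&` chart_dom d))
                     (fun x => chart_map d (chart_inv c x) 0 i).

Definition compatible_charts (R : realType) n M (c d : @chart R n M) : Prop :=
  smooth_transition c d /\ smooth_transition d c.

Record smoothManifold (R : realType) (n : nat) := SmoothManifold {
  manifold_carrier :> topologicalType;
  atlas : set (chart R n manifold_carrier);
  manifold_hausdorff : hausdorff_space manifold_carrier;
  manifold_second_countable : @second_countable manifold_carrier;
  atlas_cover : forall p, exists2 c, atlas c & chart_dom c p;
  atlas_compatible :
    forall c d, atlas c -> atlas d -> compatible_charts c d;
  atlas_maximal :
    forall c, (forall d, atlas d -> compatible_charts c d) -> atlas c }.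

(** * The algebra of smooth functions *)

Section SmoothFunctions.
Variables (R : realType) (n : nat) (M : smoothManifold R n).

Definition is_smooth (f : M -> R) : Prop :=
  forall c, atlas c -> smooth_on (chart_img c) (f \o chart_inv c).

Definition smooth_pred : {pred M -> R} := fun f => `[< is_smooth f >].

Lemma smooth_predP f : reflect (is_smooth f) (f \in smooth_pred).
Proof. exact: asboolP. Qed.

Lemma is_smooth_cst (a : R) : is_smooth (cst a).
Proof. by move=> c _ k; apply: Ck_cst; apply: chart_img_open. Qed.

Lemma is_smoothD f g : is_smooth f -> is_smooth g -> is_smooth (f + g).
Proof.
by move=> sf sg c ac k; apply: Ck_add (sf c ac k) (sg c ac k);
  apply: chart_img_open.
Qed.

Lemma is_smoothM f g : is_smooth f -> is_smooth g -> is_smooth (f * g).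
Proof.
by move=> sf sg c ac k; apply: Ck_mul (sf c ac k) (sg c ac k);
  apply: chart_img_open.
Qed.

Lemma is_smoothZ a f : is_smooth f -> is_smooth (a *: f).
Proof. exact: is_smoothM (is_smooth_cst a). Qed.

Lemma is_smoothN f : is_smooth f -> is_smooth (- f).
Proof. by move=> /(is_smoothZ (-1)); rewrite scaleN1r. Qed.

Lemma smooth_subring_closed : subring_closed smooth_pred.
Proof.
split; first exact/smooth_predP/(is_smooth_cst 1).
  move=> f g /smooth_predP sf /smooth_predP sg; apply/smooth_predP.
  by apply: is_smoothD sf _; apply: is_smoothN.
move=> f g /smooth_predP sf /smooth_predP sg; apply/smooth_predP.
exact: is_smoothM.
Qed.

Lemma smooth_scaler_closed : scaler_closed smooth_pred.
Proof. by move=> a f /smooth_predP sf; apply/smooth_predP/is_smoothZ. Qed.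

HB.instance Definition _ :=
  GRing.isSubringClosed.Build (M -> R) smooth_pred smooth_subring_closed.
HB.instance Definition _ :=
  GRing.isScaleClosed.Build R (M -> R) smooth_pred smooth_scaler_closed.

Record smoothFun := SmoothFun {
  smoothFun_val :> M -> R;
  smoothFunP : smoothFun_val \in smooth_pred }.

HB.instance Definition _ := [isSub for smoothFun_val].
HB.instance Definition _ := [Choice of smoothFun by <:].
HB.instance Definition _ :=
  GRing.SubChoice_isSubComPzRing.Build _ _ smoothFun (subringClosedP _).
HB.instance Definition _ := [SubZmodule_isSubLmodule of smoothFun by <:].

Lemma smoothFun_ext (f g : smoothFun) : (forall p, f p = g p) -> f = g.
Proof. by move=> fg; apply/val_inj/funext. Qed.

(** * Tangent spaces *)

(* The tangent space at [p] consists of the derivations at [p] of the algebra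
   of smooth functions. *)
Section TangentSpace.
Variable p : M.

Definition is_derivation_at (v : smoothFun -> R) : Prop :=
  (forall a f g, v (a *: f + g) = a * v f + v g) /\
  (forall f g, v (f * g) = v f * g p + f p * v g).

Definition derivation_pred : {pred smoothFun -> R} :=
  fun v => `[< is_derivation_at v >].

Lemma derivation_predP v :
  reflect (is_derivation_at v) (v \in derivation_pred).
Proof. exact: asboolP. Qed.

Lemma derivation_submod_closed : submod_closed derivation_pred.
Proof.
split.
  by apply/derivation_predP; split=> *; rewrite /= ?mulr0 ?mul0r ?addr0.
move=> a u v /derivation_predP [ul ud] /derivation_predP [vl vd].
apply/derivation_predP; split=> [b f g|f g].
  rewrite !fctE ul vl /GRing.scale /= !mulrDr !addrA mulrCA.
  by rewrite -!addrA; congr (_ + _); rewrite addrCA.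
rewrite !fctE ud vd /GRing.scale /= !mulrDr !mulrDl !mulrA (mulrC (f p) a).
by rewrite -!addrA; congr (_ + _); rewrite addrCA.
Qed.

HB.instance Definition _ :=
  GRing.isSubmodClosed.Build R (smoothFun -> R) derivation_pred
    derivation_submod_closed.

Record tangent := Tangent {
  tangent_val :> smoothFun -> R;
  tangentP : tangent_val \in derivation_pred }.

HB.instance Definition _ := [isSub for tangent_val].
HB.instance Definition _ := [Choice of tangent by <:].
HB.instance Definition _ := [SubChoice_isSubLmodule of tangent by <:].

Lemma tangent_lin (v : tangent) a f g : v (a *: f + g) = a * v f + v g.
Proof. by have /derivation_predP [+ _] := tangentP v; apply. Qed.

Lemma tangent_leibniz (v : tangent) f g : v (f * g) = v f * g p + f p * v g.
Proof. by have /derivation_predP [_ +] := tangentP v; apply. Qed.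

Lemma tangentD (v : tangent) f g : v (f + g) = v f + v g.
Proof. by rewrite -[f]scale1r tangent_lin mul1r scale1r. Qed.

Lemma tangentB (v : tangent) f g : v (f - g) = v f - v g.
Proof. by rewrite addrC -scaleN1r tangent_lin mulN1r addrC. Qed.

Lemma tangent_ext (v w : tangent) : (forall f, v f = w f) -> v = w.
Proof. by move=> vw; apply/val_inj/funext. Qed.

End TangentSpace.

(** * Vector fields *)

(* A section [X] of the tangent bundle is smooth when [X f] is smooth for every
   smooth function [f]. *)
Record vectorField := VectorField {
  vectorField_val :> forall p, tangent p;
  vectorFieldP : forall f, is_smooth (fun p => vectorField_val p f) }.

Lemma vectorField_ext (X Y : vectorField) :
  (forall p f, X p f = Y p f) -> X = Y.
Proof.
case: X Y => [X sX] [Y sY] /= XY.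
have E : X = Y by apply: functional_extensionality_dep => p; exact: tangent_ext.
by rewrite E in sX *; congr VectorField; exact: Prop_irrelevance.
Qed.

Definition vf_app (X : vectorField) (f : smoothFun) : smoothFun :=
  SmoothFun (introT (smooth_predP _) (vectorFieldP X f)).

Lemma vf_appE X f p : vf_app X f p = X p f.
Proof. by []. Qed.

Lemma smoothFun_smooth (f : smoothFun) : is_smooth f.
Proof. exact/smooth_predP/smoothFunP. Qed.

Definition vf_zero : vectorField :=
  @VectorField (fun p => 0) (fun f => is_smooth_cst 0).

Definition vf_add (X Y : vectorField) : vectorField :=
  @VectorField (fun p => X p + Y p)
    (fun f => is_smoothD (vectorFieldP X f) (vectorFieldP Y f)).

Definition vf_opp (X : vectorField) : vectorField :=
  @VectorField (fun p => - X p) (fun f => is_smoothN (vectorFieldP X f)).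

Definition vf_scale (h : smoothFun) (X : vectorField) : vectorField :=
  @VectorField (fun p => h p *: X p)
    (fun f => is_smoothM (smoothFun_smooth h) (vectorFieldP X f)).

HB.instance Definition _ := gen_eqMixin vectorField.
HB.instance Definition _ := gen_choiceMixin vectorField.

Fact vf_addA : associative vf_add.
Proof. by move=> X Y Z; apply: vectorField_ext => p f /=; rewrite addrA. Qed.
Fact vf_addC : commutative vf_add.
Proof. by move=> X Y; apply: vectorField_ext => p f /=; rewrite addrC. Qed.
Fact vf_add0 : left_id vf_zero vf_add.
Proof. by move=> X; apply: vectorField_ext => p f /=; rewrite add0r. Qed.
Fact vf_addN : left_inverse vf_zero vf_opp vf_add.
Proof. by move=> X; apply: vectorField_ext => p f /=; rewrite addNr. Qed.

HB.instance Definition _ :=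
  GRing.isZmodule.Build vectorField vf_addA vf_addC vf_add0 vf_addN.

Fact vf_scaleA a b X : vf_scale a (vf_scale b X) = vf_scale (a * b) X.
Proof. by apply: vectorField_ext => p f /=; rewrite scalerA. Qed.
Fact vf_scale1 : left_id 1 vf_scale.
Proof. by move=> X; apply: vectorField_ext => p f /=; rewrite scale1r. Qed.
Fact vf_scaleDr : right_distributive vf_scale +%R.
Proof. by move=> a X Y; apply: vectorField_ext => p f /=; rewrite scalerDr. Qed.
Fact vf_scaleDl X : {morph vf_scale^~ X : a b / a + b}.
Proof. by move=> a b; apply: vectorField_ext => p f /=; rewrite scalerDl. Qed.

HB.instance Definition _ :=
  GRing.Zmodule_isLmodule.Build smoothFun vectorField
    vf_scaleA vf_scale1 vf_scaleDr vf_scaleDl.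

Lemma vf_appD X f g : vf_app X (f + g) = vf_app X f + vf_app X g.
Proof. by apply: smoothFun_ext => p; rewrite /= tangentD. Qed.

Lemma vf_app_leibniz X f g : vf_app X (f * g) = vf_app X f * g + f * vf_app X g.
Proof. by apply: smoothFun_ext => p; rewrite /= tangent_leibniz. Qed.

Fact bracket_derivation (X Y : vectorField) p :
  (fun f => X p (vf_app Y f) - Y p (vf_app X f)) \in derivation_pred p.
Proof.
apply/derivation_predP; split=> [a f g|f g].
  have E (V : vectorField) : vf_app V (a *: f + g) = a *: vf_app V f + vf_app V g.
    by apply: smoothFun_ext => q; rewrite /= tangent_lin.
  by rewrite !E !tangent_lin opprD addrACA mulrBr.
rewrite !vf_app_leibniz !tangentD !tangent_leibniz !vf_appE.
by ring.
Qed.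

Fact bracket_smooth (X Y : vectorField) f :
  is_smooth (fun p => Tangent (bracket_derivation X Y p) f).
Proof.
exact: is_smoothD (vectorFieldP X (vf_app Y f))
                  (is_smoothN (vectorFieldP Y (vf_app X f))).
Qed.

Definition bracket (X Y : vectorField) : vectorField :=
  VectorField (bracket_smooth X Y).

(** * Linear connections and 1-forms *)

Record connection := Connection {
  nabla :> vectorField -> vectorField -> vectorField;
  nablaDl : forall X Y Z, nabla (X + Y) Z = nabla X Z + nabla Y Z;
  nablaZl : forall (f : smoothFun) X Z, nabla (f *: X) Z = f *: nabla X Z;
  nablaDr : forall X Y Z, nabla X (Y + Z) = nabla X Y + nabla X Z;
  nablaZr : forall X (f : smoothFun) Z,
    nabla X (f *: Z) = vf_app X f *: Z + f *: nabla X Z }.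

Definition curvature (D : connection) (X Y Z : vectorField) : vectorField :=
  D X (D Y Z) - D Y (D X Z) - D (bracket X Y) Z.

(* 1-forms are the tensor fields of type (0,1): the C^oo(M)-linear maps from
   vector fields to smooth functions. Here [scalar] refers to the ring
   [smoothFun], over which [vectorField] is a module. Likewise, 2-forms are
   given by their values on pairs of vector fields. *)
Definition oneForm := {scalar vectorField}.

(* ω_{θ,Z}(X) = θ(∇_X Z) *)
Definition omega (D : connection) (theta : oneForm) (Z X : vectorField)
  : smoothFun := theta (D X Z).

Fact omega_linear D theta Z : scalar (omega D theta Z).
Proof. by move=> f X Y; rewrite /omega nablaDl nablaZl linearP. Qed.

HB.instance Definition _ D theta Z :=
  GRing.isLinear.Build smoothFun vectorField smoothFun *%R (omega D theta Z)
    (omega_linear D theta Z).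

(* (∇_X θ)(Y) = X(θ(Y)) - θ(∇_X Y) *)
Definition nabla_form (D : connection) (X : vectorField) (theta : oneForm)
  (Y : vectorField) : smoothFun := vf_app X (theta Y) - theta (D X Y).

Fact nabla_form_linear D X theta : scalar (nabla_form D X theta).
Proof.
move=> f Y Z; rewrite /nabla_form nablaDr nablaZr !linearP !linearD !linearZ /=.
rewrite vf_appD vf_app_leibniz; ring.
Qed.

HB.instance Definition _ D X theta :=
  GRing.isLinear.Build smoothFun vectorField smoothFun *%R
    (nabla_form D X theta) (nabla_form_linear D X theta).

Definition ext_d (w : oneForm) (X Y : vectorField) : smoothFun :=
  vf_app X (w Y) - vf_app Y (w X) - w (bracket X Y).

(* ℜ_{θ,Z}(X,Y) = θ(ℜ(X,Y)Z) *)
Definition curvature_form (D : connection) (theta : oneForm)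
  (Z X Y : vectorField) : smoothFun := theta (curvature D X Y Z).

(* (∇θ ∧ ∇Z)(X,Y) *)
Definition nabla_wedge (D : connection) (theta : oneForm)
  (Z X Y : vectorField) : smoothFun :=
  nabla_form D X theta (D Y Z) - nabla_form D Y theta (D X Z).

Definition Psi (D : connection) (theta : oneForm) (Z X Y : vectorField)
  : smoothFun :=
  nabla_form D Y theta (D X Z) - nabla_form D X theta (D Y Z).

End SmoothFunctions.

(* Main.v *)
Require Import Defs.
From mathcomp Require Import all_boot all_order all_algebra.
From mathcomp Require Import all_classical all_reals all_analysis.
From mathcomp Require Import ring.

Import GRing.Theory.
Local Open Scope classical_set_scope.
Local Open Scope ring_scope.

(** By the Leibniz definition of ∇θ, θ(∇_X ∇_Y Z) = X(θ(∇_Y Z)) - (∇_X θ)(∇_Y Z). Antisymmetrize in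
    X, Y and subtract θ(∇_[X,Y] Z): the derivatives of ω_{θ,Z} and the bracket term make up
    dω_{θ,Z}, and the ∇θ terms make up Ψ_{θ,Z}. *)

Lemma Psi_nabla_wedge (R : realType) (n : nat) (M : smoothManifold R n)
  (D : connection M) (theta : oneForm M) (Z : vectorField M) :
  Psi D theta Z = - nabla_wedge D theta Z.
Proof.
by apply/funext => X; apply/funext => Y; exact/esym/opprB.
Qed.

Lemma curvature_form_Psi (R : realType) (n : nat) (M : smoothManifold R n)
  (D : connection M) (theta : oneForm M) (Z : vectorField M) :
  curvature_form D theta Z = ext_d (omega D theta Z) + Psi D theta Z.
Proof.
apply/funext => X; apply/funext => Y; rewrite !fctE.
(* Additivity of [theta] splits the curvature into three terms; X(θ(∇_Y Z)) and Y(θ(∇_X Z)) then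
   occur in dω and Ψ with opposite signs, so [ring] closes the goal in [smoothFun]. *)
rewrite /curvature_form /curvature /ext_d /Psi /nabla_form /= /omega !linearB /=.
by ring.
Qed.

Theorem corollary2p8 (R : realType) (n : nat) (M : smoothManifold R n)
  (Mconn : connected [set: M]) (D : connection M) (theta : oneForm M)
  (Z : vectorField M) :
  [/\ curvature_form D theta Z = ext_d (omega D theta Z) + Psi D theta Z,
      curvature_form D theta Z = ext_d (omega D theta Z) - nabla_wedge D theta Z
    & Psi D theta Z = - nabla_wedge D theta Z].
Proof.
split; last exact: Psi_nabla_wedge.
  exact: curvature_form_Psi.
by rewrite -Psi_nabla_wedge curvature_form_Psi.
Qed.
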